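(* For every integer $n\ge 0$, \[ \tilde{\mathrm{err}}(n,0)\equiv E(n)\pmod{\mathrm{Ker}(L)},\qquad \tilde{\mathrm{err}}(n,1)\equiv S_{-1}(E(n))\pmod{\mathrm{Ker}(L)}, \] where $E(n)=\sum_{T\in\mathrm{RV}_{n;2}}\mathrm{sgn}(T)\,\tilde h_{\mathrm{val}(T)}\in\tilde{\mathrm{CH}}_2$, and $\tilde{\mathrm{err}}(n,0),\tilde{\mathrm{err}}(n,1)\in\tilde{\mathrm{CH}}_2$ are defined recursively by $\tilde{\mathrm{err}}(0,0)=\tilde h_2$, $\tilde{\mathrm{err}}(0,1)=\tilde h_1$ and \[ \tilde{\mathrm{err}}(n+1,0)=\big(\tilde{\mathrm{err}}(n,0)^2-\tilde{\mathrm{err}}(n,1)^2\big)\tilde{\mathrm{err}}(n,0), \] \[ \tilde{\mathrm{err}}(n+1,1)=\big(2\,\tilde{\mathrm{err}}(n,0)^2-\tilde h_1\,\tilde{\mathrm{err}}(n,1)\,\tilde{\mathrm{err}}(n,0)\big)\tilde{\mathrm{err}}(n,1). \]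
   Context: Let $\tau:\mathbb{Z}\to\mathbb{Z}$, $\tau(i)=|i+1|-1$. The ring $\tilde{\mathrm{CH}}_2$ is generated by elements $\tilde h_i$, $i\in\mathbb{Z}$; its elements are finite integer linear combinations of the (linearly independent) symbols $\tilde h_i$, and multiplication is the $\mathbb{Z}$-bilinear extension of the rules: $\tilde h_{-1}\tilde h_j=0$; $\tilde h_i\tilde h_j=\sum_{k=0}^{i}\tilde h_{j-i+2k}$ if $i\ge 0$; $\tilde h_i\tilde h_j=-\tilde h_{\tau(i)}\tilde h_j$ if $i<-1$. The ring $\mathrm{CH}_2$ has as elements finite integer linear combinations of linearly independent symbols $h_i$, $i\ge 0$ (with $h_ih_j=\sum_{k=0}^{\min(i,j)}h_{|j-i|+2k}$). $L:\tilde{\mathrm{CH}}_2\to\mathrm{CH}_2$ is the linear map (a ring homomorphism) with $L(\tilde h_i)=\mathrm{sgn}(i+1)h_{\tau(i)}$ (so $L(\tilde h_{-1})=0$), and $\mathrm{Ker}(L)$ is its kernel. For $k\in\mathbb{Z}$, $S_k$ is the linear operator on $\tilde{\mathrm{CH}}_2$ with $S_k(\tilde h_i)=\tilde h_{i+k}$. Radius-value trees: a radius-value tree of height $0$ is a single vertex labeled by an even integer; its value is that label. A radius-value tree of height $n+1$ is a 4-tuple $T=(l,T_1,T_2,T_3)$ where $l$ is an even integer, $T_1,T_2,T_3$ are radius-value trees of height $n$ (children of the root, in this order, forming a rooted plane ternary tree), and $|l-\mathrm{val}(T_1)-\mathrm{val}(T_3)|\le\tau(\mathrm{val}(T_2))$;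 the value is $\mathrm{val}(T)=l$. The sign is $\mathrm{sgn}(T)=1$ for height $0$ and otherwise $\mathrm{sgn}(T)=\mathrm{sgn}(\mathrm{val}(T_2)+1)\mathrm{sgn}(T_1)\mathrm{sgn}(T_2)\mathrm{sgn}(T_3)$. $\mathrm{RV}_{n;2}$ is the set of radius-value trees of height $n$ all of whose leaves have label $2$. *)

(* Defs.v *)
From HB Require Import structures.
From mathcomp Require Import all_boot all_order all_algebra finmap.
From mathcomp Require Import boolp classical_sets functions cardinality fsbigop.
From mathcomp Require Import zify.
From mathcomp.multinomials Require Import monalg.

Set Implicit Arguments.
Unset Strict Implicit.
Unset Printing Implicit Defensive.

Import Order.TTheory GRing.Theory Num.Theory.
Local Open Scope classical_set_scope.
Local Open Scope ring_scope.

Definition tau (i : int) : int := `|i + 1| - 1.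

(* Additive groups only.  The product of the first one is [mulCHt] below: it
   has no two-sided unit and is not the product of a monoid algebra, hence it
   cannot be a MathComp ring structure. *)
Notation CHt2 := {malg int[int]}.
Notation CH2 := {malg int[nat]}.

Definition ht (i : int) : CHt2 := << i >>.
Definition h (i : nat) : CH2 := << i >>.

Section LinearExtension.
Variables (K : choiceType) (V : zmodType) (f : K -> V).

Definition linext (x : {malg int[K]}) : V :=
  \sum_(i <- msupp x) f i *~ x@_i.

Lemma linextEw (x : {malg int[K]}) (d : {fset K}) :
  (msupp x `<=` d)%fset -> linext x = \sum_(i <- d) f i *~ x@_i.
Proof.
move=> sub; rewrite /linext (big_fset_incl _ sub) // => i _ /mcoeff_outdom ->.
by rewrite mulr0z.
Qed.

Lemma linext_is_zmod_morphism : zmod_morphism linext.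
Proof.
move=> x y.
rewrite (linextEw (msuppB_le x y)) (linextEw (fsubsetUl _ (msupp y))).
rewrite (linextEw (fsubsetUr (msupp x) (msupp y))) -sumrB.
by apply: eq_bigr => i _; rewrite mcoeffB mulrzBr.
Qed.

HB.instance Definition _ :=
  GRing.isZmodMorphism.Build {malg int[K]} V linext linext_is_zmod_morphism.

Lemma linextU (i : K) : linext << i >> = f i.
Proof.
by rewrite (linextEw (@msuppU_le _ _ i 1)) big_seq_fset1 mcoeffUU mulr1z.
Qed.

End LinearExtension.

Lemma linextB (K : choiceType) (V : zmodType) (f g : K -> V) x :
  linext (fun i => f i - g i) x = linext f x - linext g x.
Proof. by rewrite /linext -sumrB; apply: eq_bigr => i _; rewrite mulrzBl. Qed.

(* ht_i * ht_j for i >= 0 *)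
Definition mulht_nneg (i : nat) (j : int) : CHt2 :=
  \sum_(0 <= k < i.+1) ht (j - i%:Z + 2 * k%:Z).

Definition mulht (i j : int) : CHt2 :=
  if i == -1 then 0
  else if 0 <= i then mulht_nneg `|i|%N j
  else - mulht_nneg `|tau i|%N j.

Definition mulCHt (x y : CHt2) : CHt2 :=
  linext (fun i => linext (mulht i) y) x.

Declare Scope CHt_scope.
Delimit Scope CHt_scope with CHt.
Notation "x ** y" := (mulCHt x y)
  (at level 40, left associativity) : CHt_scope.
Local Open Scope CHt_scope.

Lemma mulCHt_ht (i j : int) : ht i ** ht j = mulht i j.
Proof. by rewrite /mulCHt !linextU. Qed.

Lemma mulCHtBl (x y z : CHt2) : (x - y) ** z = x ** z - y ** z.
Proof. exact: raddfB. Qed.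

Lemma mulCHtBr (x y z : CHt2) : x ** (y - z) = x ** y - x ** z.
Proof.
rewrite /mulCHt -linextB; congr (linext _ x); apply/funext => i.
exact: raddfB.
Qed.

(* For i = -1 the coefficient is 0, so that the truncation of the negative
   index tau (-1) = -1 is harmless. *)
Definition L : CHt2 -> CH2 :=
  linext (fun i : int => h `|tau i|%N *~ Num.sg (i + 1)).

Definition KerL : set CHt2 := [set x | L x = 0].

Definition congr_KerL (x y : CHt2) : Prop := KerL (x - y).

Definition S_ (k : int) : CHt2 -> CHt2 := linext (fun i => ht (i + k)).

Inductive ltree : Type :=
| Leaf of int
| Node of int & ltree & ltree & ltree.

Fixpoint ltree_encode (T : ltree) : GenTree.tree int :=
  match T with
  | Leaf l => GenTree.Leaf l
  | Node l T1 T2 T3 => GenTree.Node 0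
      [:: GenTree.Leaf l; ltree_encode T1; ltree_encode T2; ltree_encode T3]
  end.

Fixpoint ltree_decode (t : GenTree.tree int) : option ltree :=
  match t with
  | GenTree.Leaf l => Some (Leaf l)
  | GenTree.Node _ [:: GenTree.Leaf l; t1; t2; t3] =>
      match ltree_decode t1, ltree_decode t2, ltree_decode t3 with
      | Some T1, Some T2, Some T3 => Some (Node l T1 T2 T3)
      | _, _, _ => None
      end
  | _ => None
  end.

Lemma ltree_encodeK : pcancel ltree_encode ltree_decode.
Proof. by elim=> [//|l T1 IH1 T2 IH2 T3 IH3] /=; rewrite IH1 IH2 IH3. Qed.

HB.instance Definition _ := Countable.copy ltree (pcan_type ltree_encodeK).

Definition rvval (T : ltree) : int :=
  match T with Leaf l => l | Node l _ _ _ => l end.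

Fixpoint rvtree (n : nat) (T : ltree) : bool :=
  match n, T with
  | 0%N, Leaf l => (2 %| l)%Z
  | n'.+1, Node l T1 T2 T3 =>
      [&& (2 %| l)%Z, rvtree n' T1, rvtree n' T2, rvtree n' T3
        & `|l - rvval T1 - rvval T3| <= tau (rvval T2)]
  | _, _ => false
  end.

Fixpoint rvsgn (T : ltree) : int :=
  match T with
  | Leaf _ => 1
  | Node _ T1 T2 T3 => Num.sg (rvval T2 + 1) * rvsgn T1 * rvsgn T2 * rvsgn T3
  end.

Fixpoint leaves_eq (a : int) (T : ltree) : bool :=
  match T with
  | Leaf l => l == a
  | Node _ T1 T2 T3 => [&& leaves_eq a T1, leaves_eq a T2 & leaves_eq a T3]
  end.

Definition RV (n : nat) (a : int) : set ltree :=
  [set T | rvtree n T /\ leaves_eq a T].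

(* Needed for the sum over RV n 2 to be a genuine one: \sum_(T \in A) is 0 by
   convention when infinitely many terms are nonzero. *)
Lemma finite_RV (n : nat) (a : int) : finite_set (RV n a).
Proof.
elim: n => [|n IHn].
  apply: (@sub_finite_set _ _ [set Leaf a]); last exact: finite_set1.
  by case=> [l|l T1 T2 T3] [] //= _ /eqP ->.
have fin3 := finite_setX (finite_setX IHn IHn) IHn.
pose F (p : ltree * ltree * ltree) : set ltree :=
  (fun k : nat =>
     Node (rvval p.1.1 + rvval p.2 - tau (rvval p.1.2) + k%:Z) p.1.1 p.1.2 p.2)
  @` `I_(`|(2 * tau (rvval p.1.2))%R|%N.+1).
pose D := RV n a `*` RV n a `*` RV n a.
apply: (@sub_finite_set _ _ (\bigcup_(p in D) F p)); last first.
  apply: (bigcup_finite fin3).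
  by move=> p _; apply: finite_image; apply: finite_II.
case=> [l [] //|l T1 T2 T3].
move=> [/= /and5P[_ r1 r2 r3 le_l] /and3P[a1 a2 a3]].
exists (T1, T2, T3) => //=.
exists `|(l - rvval T1 - rvval T3 + tau (rvval T2))%R|%N => /=.
  by move: le_l; lia.
by congr Node; move: le_l; lia.
Qed.

Definition E (n : nat) : CHt2 :=
  \sum_(T \in RV n 2) rvsgn T *: ht (rvval T).

Fixpoint err (n : nat) : CHt2 * CHt2 :=
  match n with
  | 0%N => (ht 2, ht 1)
  | n'.+1 =>
      let: (e0, e1) := err n' in
      ((e0 ** e0 - e1 ** e1) ** e0,
       ((e0 ** e0) *+ 2 - ht 1 ** e1 ** e0) ** e1)
  end.

Definition err0 (n : nat) : CHt2 := (err n).1.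
Definition err1 (n : nat) : CHt2 := (err n).2.

(* Main.v *)
From HB Require Import structures.
Require Import Defs.
From mathcomp Require Import all_boot all_order all_algebra.
From mathcomp Require Import finmap boolp classical_sets fsbigop zify ring.
From mathcomp.multinomials Require Import monalg.

Set Implicit Arguments.
Unset Strict Implicit.
Unset Printing Implicit Defensive.

Import Order.TTheory GRing.Theory Num.Theory.

Local Open Scope ring_scope.
Local Open Scope CHt_scope.

(** Send [ht i] to [x ^ i] in a field. Then [L] becomes
    [P(x) |-> (x P(x) - x^-1 P(x^-1)) / (x - x^-1)], which is multiplicative for
    [mulCHt] and, when [x] is transcendental, has the same kernel as [L].
    If [P n] is the image of [E n], splitting a tree at its root gives
    [P n.+1 = (P n) ^+ 2 * L (E n)]: the second child contributes the geometric
    sum [x ^ (- t) + x ^ (2 - t) + ... + x ^ t] with [t = tau (val T2)].  The same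
    factor [L (E n)], being invariant under [x |-> x^-1], occurs in
    [P n.+1 (x^-1)], so the recursion for [err] reduces to two rational
    identities in [x], [P n (x)] and [P n (x^-1)]. *)

Lemma raddf_linext (K : choiceType) (V W : zmodType) (g : {additive V -> W})
    (f : K -> V) (x : {malg int[K]}) :
  g (linext f x) = linext (fun i => g (f i)) x.
Proof. by rewrite raddf_sum; apply: eq_bigr => i _; rewrite raddfMz. Qed.

Lemma eq_linext (K : choiceType) (V : zmodType) (f g : K -> V) :
  f =1 g -> linext f =1 linext g.
Proof. by move=> /funext ->. Qed.

(** The side condition that [field] leaves after clearing [x^-1]. *)
Lemma sqr_sub1_neq0 (F : fieldType) (x : F) :
  x != 0 -> x - x^-1 != 0 -> x * x - 1 != 0.
Proof. by move=> x0 xV; rewrite -(mulfV x0) -mulrBr mulf_neq0. Qed.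

(** * Evaluation at a point of a field and Chebyshev values *)

Section Evaluation.
Variables (F : fieldType) (x : F).

Definition evz (y : F) : CHt2 -> F := linext (fun i : int => y ^ i).

HB.instance Definition _ y :=
  GRing.Additive.copy (evz y) (linext (fun i : int => y ^ i)).

(* The Chebyshev value [h i], extended to negative indices by [cheb (-2 - i) = - cheb i]. *)
Definition cheb (i : int) : F := (x ^ (i + 1) - x ^ (- (i + 1))) / (x - x^-1).

Definition evcheb : CHt2 -> F := linext cheb.

HB.instance Definition _ := GRing.Additive.copy evcheb (linext cheb).

Hypotheses (x_neq0 : x != 0) (x_neqV : x - x^-1 != 0).

Lemma evchebE y :
  evcheb y = (x * evz x y - x^-1 * evz x^-1 y) / (x - x^-1).
Proof.
rewrite /evcheb /evz /linext !mulr_sumr -sumrB mulr_suml.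
apply: eq_bigr => i _; rewrite /cheb !mulrzAr -mulrzBl mulrzAl.
congr (_ / _ *~ _); rewrite exprz_inv opprD !expfzDr // expr1z.
by rewrite [x ^ -1]exprN1 mulrC [_ * x^-1]mulrC.
Qed.

Lemma evcheb_shift y : evcheb (S_ (-1) y) = (evz x y - evz x^-1 y) / (x - x^-1).
Proof.
rewrite /S_ [LHS]raddf_linext /evz -linextB /linext mulr_suml.
apply: eq_bigr => i _; rewrite /= /evcheb /ht linextU /cheb subrK exprz_inv.
by rewrite mulrzAl.
Qed.

(** Telescopes, since [x ^ i * (x - x^-1) = x ^ (i + 1) - x ^ (i - 1)]. *)
Lemma sum_expz (m : int) (n : nat) :
  \sum_(0 <= k < n) x ^ (m + 2 * k%:Z) =
  (x ^ (m + 2 * n%:Z - 1) - x ^ (m - 1)) / (x - x^-1).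
Proof.
elim: n => [|n IHn]; first by rewrite big_geq // mulr0 addr0 subrr mul0r.
rewrite big_nat_recr //= {}IHn.
have -> : m + 2 * n.+1%:Z - 1 = (m + 2 * n%:Z) + 1 by lia.
by rewrite !expfzDr // expr1z [x ^ -1]exprN1; field; rewrite x_neq0 sqr_sub1_neq0.
Qed.

Lemma sum_cheb (m : int) (n : nat) :
  \sum_(0 <= k < n) cheb (m + 2 * k%:Z) =
  (x ^ (m + 2 * n%:Z) + x ^ (- (m + 2 * n%:Z)) - x ^ m - x ^ (- m))
    / (x - x^-1) ^+ 2.
Proof.
elim: n => [|n IHn].
  by rewrite big_geq // mulr0 addr0 -addrA -opprD subrr mul0r.
rewrite big_nat_recr //= {}IHn /cheb.
have -> : m + 2 * n.+1%:Z = (m + 2 * n%:Z) + 1 + 1 by lia.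
rewrite -!invr_expz !expfzDr // expr1z.
by field; rewrite x_neq0 sqr_sub1_neq0 ?expfz_neq0.
Qed.

Lemma cheb_nat (n : nat) (j : int) :
  \sum_(0 <= k < n.+1) x ^ (j - n%:Z + 2 * k%:Z) = x ^ j * cheb n.
Proof.
rewrite sum_expz /cheb.
have -> : j - n%:Z + 2 * n.+1%:Z - 1 = j + (n%:Z + 1) by lia.
have -> : j - n%:Z - 1 = j - (n%:Z + 1) by lia.
by rewrite mulrA mulrBr -!expfzDr.
Qed.

(** The Clebsch-Gordan rule for characters of SL2; the odd symmetry of [cheb] about -1 keeps it
    valid for every integer [j]. *)
Lemma cheb_mul_nat (n : nat) (j : int) :
  \sum_(0 <= k < n.+1) cheb (j - n%:Z + 2 * k%:Z) = cheb n * cheb j.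
Proof.
rewrite sum_cheb /cheb.
have -> : j - n%:Z + 2 * n.+1%:Z = j + 1 + (n%:Z + 1) by lia.
have -> : j - n%:Z = j + 1 - (n%:Z + 1) by lia.
rewrite -!invr_expz; move: (n%:Z + 1) (j + 1) => a b.
rewrite !expfzDr // -!invr_expz.
by field; rewrite x_neq0 sqr_sub1_neq0 ?expfz_neq0.
Qed.

(** [tau i] is [i] or its reflection [-2 - i], and [cheb] is odd under that reflection. *)
Lemma cheb_tau (i : int) : cheb `|tau i|%N *~ Num.sg (i + 1) = cheb i.
Proof.
case: (ltrgtP i (-1)) => [lt_i|gt_i|->].
- rewrite ltr0_sg; last by lia.
  rewrite mulrN1z /cheb; have -> : `|tau i|%N%:Z + 1 = - (i + 1) by rewrite /tau; lia.
  by rewrite opprK -mulNr opprB.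
- rewrite gtr0_sg; last by lia.
  by have -> : `|tau i|%N%:Z = i by rewrite /tau; lia.
- by rewrite addNr sgr0 mulr0z /cheb addNr oppr0 subrr mul0r.
Qed.

Lemma evcheb_mulht (i j : int) : evcheb (mulht i j) = cheb i * cheb j.
Proof.
have nneg n : evcheb (mulht_nneg n j) = cheb n * cheb j.
  rewrite -cheb_mul_nat raddf_sum; apply: eq_bigr => k _.
  exact: linextU.
rewrite /mulht -[cheb i]cheb_tau.
case: eqP => [->|ni]; first by rewrite addNr sgr0 mulr0z mul0r raddf0.
case: ifP => i_ge0.
  rewrite nneg gtr0_sg ?mulr1z; last by lia.
  by congr (cheb _ * _); rewrite /tau; lia.
by rewrite raddfN /= nneg ltr0_sg ?mulrN1z ?mulNr //; lia.
Qed.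

Lemma evchebM (y z : CHt2) : evcheb (y ** z) = evcheb y * evcheb z.
Proof.
rewrite /mulCHt [LHS]raddf_linext [evcheb y]/linext mulr_suml.
apply: eq_bigr => i _; rewrite mulrzAl; congr (_ *~ _).
rewrite [LHS]raddf_linext [evcheb z]/linext mulr_sumr.
by apply: eq_bigr => j _; rewrite /= evcheb_mulht mulrzAr.
Qed.

(** Clears negative exponents: as [i < N], the subtraction [N - i.+1] is not truncated, and the two
    exponents lie on either side of [N]. *)
Lemma expr_cheb (N i : nat) :
  (i < N)%N -> x ^+ N * (x - x^-1) * cheb i = x ^+ (N + i.+1) - x ^+ (N - i.+1).
Proof.
move=> lt_iN; rewrite /cheb mulrCA mulfK // mulrC mulrBr !exprnP -!expfzDr //.
by congr (x ^ _ - x ^ _); lia.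
Qed.

(** Evaluation factors through [L], so its kernel is [KerL] as soon as the values [cheb i],
    [i >= 0], are linearly independent. *)
Lemma evcheb_L (y : CHt2) : evcheb y = linext (fun i : nat => cheb i) (L y).
Proof.
rewrite /L raddf_linext; apply: eq_linext => i /=.
by rewrite raddfMz /= /h linextU cheb_tau.
Qed.

End Evaluation.

Lemma chebV (F : fieldType) (x : F) : cheb x^-1 =1 cheb x.
Proof.
move=> i; rewrite /cheb !exprz_inv !opprK invrK.
by rewrite -[x^-1 - x]opprB invrN mulrN -mulNr opprB.
Qed.

(** * Independence of the Chebyshev values at [f 'X], transcendental because [f] is injective *)

Section Transcendental.
Variables (F : fieldType) (f : {rmorphism {poly int} -> F}).
Hypothesis f_inj : injective f.

Lemma rmorph_polyX_neq0 : f 'X != 0.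
Proof. by rewrite -(rmorph0 f) (inj_eq f_inj) polyX_eq0. Qed.

Lemma rmorph_polyX_neqV : f 'X - (f 'X)^-1 != 0.
Proof.
rewrite -(inj_eq (mulfI rmorph_polyX_neq0)) mulr0 mulrBr mulfV ?rmorph_polyX_neq0 //.
rewrite -(rmorph1 f) -rmorphM -rmorphB -(rmorph0 f) (inj_eq f_inj) -expr2.
by rewrite -size_poly_eq0 size_XnsubC.
Qed.

Lemma linext_cheb_eq0 (y : CH2) :
  linext (fun i : nat => cheb (f 'X) i) y = 0 -> y = 0.
Proof.
move=> y0; pose N := (\max_(i <- msupp y) i.+1)%N.
have ltN i : i \in msupp y -> (i < N)%N.
  by move=> yi; exact: (@leq_bigmax_seq _ _ _ (fun i => i.+1)).
pose p : {poly int} :=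
  \sum_(i <- msupp y) ('X^(N + i.+1) - 'X^(N - i.+1)) *~ y@_i.
have p0 : p = 0.
  apply: f_inj; rewrite rmorph0.
  transitivity (f 'X ^+ N * (f 'X - (f 'X)^-1) *
                linext (fun i : nat => cheb (f 'X) i) y).
    rewrite /p /linext rmorph_sum mulr_sumr; apply: eq_big_seq => i yi.
    rewrite rmorphMz mulrzAr rmorphB !rmorphXn.
    by rewrite expr_cheb ?ltN ?rmorph_polyX_neq0 ?rmorph_polyX_neqV.
  by rewrite y0 mulr0.
apply/malgP => k; rewrite mcoeff0.
have [yk|] := boolP (k \in msupp y); last exact: mcoeff_outdom.
(* Only the term [i = k] contributes in degree [N + k + 1]: the leading exponents [N + i + 1] are
   distinct, and the subtracted powers have degree below [N]. *)
have := congr1 (fun q : {poly int} => q`_(N + k.+1)) p0.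
rewrite /p coef_sum coef0 (bigD1_seq k) //=.
rewrite big1_seq ?addr0 => [|i /andP[ik yi]].
  rewrite coefMrz coefB !coefXn eqxx.
  have -> : (N + k.+1 == N - k.+1)%N = false by lia.
  by rewrite subr0 intz.
rewrite coefMrz coefB !coefXn eqn_add2l eqSS eq_sym (negbTE ik).
have -> : (N + k.+1 == N - i.+1)%N = false by lia.
by rewrite subrr mul0rz.
Qed.

End Transcendental.

(** * Enumeration of the radius-value trees *)

(* The labels of even parity allowed by the condition on [l], indexed by
   [0 <= k <= tau (rvval T2)]. *)
Definition rvnode (p : ltree * (ltree * ltree)) (k : nat) : ltree :=
  Node (rvval p.1 + rvval p.2.2 - tau (rvval p.2.1) + 2 * k%:Z)
    p.1 p.2.1 p.2.2.

(** For an even value [tau] is nonnegative, so the absolute value only converts it to [nat]; at -1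
    it would give two labels instead of none. *)
Definition rvstep (s : seq ltree) : seq ltree :=
  [seq rvnode p k
     | p <- [seq (T1, q) | T1 <- s, q <- [seq (T2, T3) | T2 <- s, T3 <- s]],
       k <- iota 0 `|tau (rvval p.2.1)|%N.+1].

Definition rvs (a : int) (n : nat) : seq ltree := iter n rvstep [:: Leaf a].

Lemma rvs_uniq a n : uniq (rvs a n).
Proof.
elim: n => // n IHn; rewrite /rvs iterS; apply: allpairs_uniq_dep => [|p _|].
- apply: allpairs_uniq => //; last by move=> [? ?] [? ?] _ _ [-> ->].
  by apply: allpairs_uniq => // - [? ?] [? ?] _ _ [-> ->].
- exact: iota_uniq.
move=> [[T1 [T2 T3]] k] [[U1 [U2 U3]] l] _ _ [+ e1 e2 e3].
by rewrite /= e1 e2 e3 => kl; have -> : k = l by lia.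
Qed.

Lemma rvtree_even n T : rvtree n T -> (2 %| rvval T)%Z.
Proof. by case: n T => [|n] [l|l T1 T2 T3] //= /andP[]. Qed.

Lemma mem_rvs a n T :
  (2 %| a)%Z -> (T \in rvs a n) = rvtree n T && leaves_eq a T.
Proof.
move=> a_even; elim: n T => [|n IHn] T.
  case: T => [l|l T1 T2 T3] /=; last by rewrite inE.
  by rewrite inE; apply/eqP/andP => [[->]|[_ /eqP ->]].
rewrite /rvs iterS; apply/allpairsPdep/andP => [[p [k [+ + ->]]]|].
  rewrite [k \in _]mem_iota.
  case/allpairsP => -[T1 q] /= [+ + ->] /=.
  rewrite IHn => /andP[r1 l1].
  case/allpairsP => -[T2 T3] /= [+ + ->] /=.
  rewrite !IHn => /andP[r2 l2] /andP[r3 l3] kle.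
  rewrite r1 r2 r3 l1 l2 l3 /=; split=> //.
  move: kle (rvtree_even r1) (rvtree_even r2) (rvtree_even r3).
  by rewrite /tau => *; apply/andP; split; lia.
case: T => [l []//|l T1 T2 T3 [/= /and5P[l0 r1 r2 r3 le] /and3P[l1 l2 l3]]].
exists (T1, (T2, T3)).
(* Inverts the label formula of [rvnode]; the division is exact because all values are even and
   [tau] preserves evenness. *)
exists `|(l - rvval T1 - rvval T3 + tau (rvval T2)) %/ 2|%Z%N; split.
- apply: allpairs_f; first by rewrite IHn r1.
  by apply: allpairs_f; rewrite IHn ?r2 ?r3.
- by rewrite -[X in _ \in X]/(iota 0 _.+1) mem_iota /=; lia.
rewrite /rvnode /=; congr Node.
move: l0 le (rvtree_even r1) (rvtree_even r2) (rvtree_even r3).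
by rewrite /tau; lia.
Qed.

(** Trades the sum over a finite set for one over a list, which can be split at the root. *)
Lemma raddf_E (V : zmodType) (g : {additive CHt2 -> V}) n :
  g (E n) = \sum_(T <- rvs 2 n) g (ht (rvval T)) *~ rvsgn T.
Proof.
have -> : E n = \sum_(T <- rvs 2 n) rvsgn T *: ht (rvval T).
  rewrite fsbig_seq ?rvs_uniq //; apply: eq_fsbigl.
  by apply/seteqP; split=> T /=; rewrite mem_rvs // => /andP.
rewrite raddf_sum; apply: eq_bigr => T _.
by rewrite -[in LHS](intz (rvsgn T)) scaler_int raddfMz.
Qed.

(** * Splitting a tree at its root *)

Section Recursion.
Variables (F : fieldType) (x : F).
Hypotheses (x_neq0 : x != 0) (x_neqV : x - x^-1 != 0).

Lemma evz_ht (y : F) i : evz y (ht i) = y ^ i.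
Proof. exact: linextU. Qed.

Lemma evcheb_ht i : evcheb x (ht i) = cheb x i.
Proof. exact: linextU. Qed.

(** Over fixed children the labels form a progression of step 2 centred at [rvval T1 + rvval T3].
    Its sum is a power of [x] times [cheb] at [tau (rvval T2)], and the sign of the node turns the
    latter into [cheb x (rvval T2)]. *)
Lemma sum_rvnode T1 T2 T3 :
  \sum_(k <- iota 0 `|tau (rvval T2)|%N.+1)
     x ^ rvval (rvnode (T1, (T2, T3)) k) *~ rvsgn (rvnode (T1, (T2, T3)) k) =
  x ^ rvval T1 *~ rvsgn T1 *
    (cheb x (rvval T2) *~ rvsgn T2 * (x ^ rvval T3 *~ rvsgn T3)).
Proof.
rewrite -[cheb x _]cheb_tau // -mulrz_suml !(mulrzAl, mulrzAr) -!mulrzA.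
have -> : rvsgn T3 * (Num.sg (rvval T2 + 1) * (rvsgn T2 * rvsgn T1)) =
          rvsgn (Node 0 T1 T2 T3) by rewrite /=; ring.
(* At -1 the list has two spurious labels, but the sign 0 kills both sides. *)
have [v2|v2] := eqVneq (rvval T2) (-1).
  by rewrite /= v2 addNr sgr0 !mul0r !mulr0z.
congr (_ *~ _).
have := cheb_nat x_neq0 x_neqV `|tau (rvval T2)| (rvval T1 + rvval T3).
rewrite /index_iota subn0.
have tauE : (`|tau (rvval T2)|%N : int) = tau (rvval T2) by rewrite /tau; lia.
rewrite tauE => ->; rewrite expfzDr //; ring.
Qed.

Lemma evz_ES n : evz x (E n.+1) = evz x (E n) ^+ 2 * evcheb x (E n).
Proof.
rewrite !raddf_E [rvs 2 n.+1]iterS big_allpairs_dep big_allpairs.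
rewrite expr2 -mulrA mulr_suml; apply: eq_bigr => T1 _.
(* The factor [evcheb x (E n)], coming from [T2], moves between those of [T1] and [T3] to match the
   nesting of the sums. *)
rewrite big_allpairs [X in _ = _ * X]mulrC mulr_suml mulr_sumr.
apply: eq_bigr => T2 _; rewrite 2!mulr_sumr; apply: eq_bigr => T3 _.
rewrite /= !evz_ht evcheb_ht -sum_rvnode.
by apply: eq_bigr => k _; rewrite evz_ht.
Qed.

End Recursion.

(** * The error recursion under evaluation *)

Section Invariant.
Variables (F : fieldType) (x : F).
Hypotheses (x_neq0 : x != 0) (x_neqV : x - x^-1 != 0).

Lemma evzV_ES n : evz x^-1 (E n.+1) = evz x^-1 (E n) ^+ 2 * evcheb x (E n).
Proof.
rewrite evz_ES ?invr_eq0 // ?invrK -1?opprB ?oppr_eq0 //.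
by congr (_ * _); apply: eq_linext; exact: chebV.
Qed.

Lemma evchebB : {morph evcheb x : y z / y - z}.
Proof. exact: raddfB. Qed.

Lemma evchebMn n : {morph evcheb x : y / y *+ n}.
Proof. exact: raddfMn. Qed.

Lemma evcheb_err0S n :
  evcheb x (err0 n.+1) =
  (evcheb x (err0 n) ^+ 2 - evcheb x (err1 n) ^+ 2) * evcheb x (err0 n).
Proof.
rewrite /err0 /err1 /=; case: (err n) => e0 e1 /=.
by rewrite evchebM // evchebB !evchebM.
Qed.

Lemma evcheb_err1S n :
  evcheb x (err1 n.+1) =
  (evcheb x (err0 n) ^+ 2 *+ 2
   - (x + x^-1) * evcheb x (err1 n) * evcheb x (err0 n)) * evcheb x (err1 n).
Proof.
have -> : x + x^-1 = evcheb x (ht 1).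
  rewrite evcheb_ht /cheb -invr_expz expfzDr // expr1z.
  by field; rewrite x_neq0 sqr_sub1_neq0.
rewrite /err0 /err1 /=; case: (err n) => e0 e1 /=.
by rewrite evchebM // evchebB evchebMn !evchebM.
Qed.

Lemma evcheb_err n :
  evcheb x (err0 n) = evcheb x (E n) /\
  evcheb x (err1 n) = evcheb x (S_ (-1) (E n)).
Proof.
elim: n => [|n [IH0 IH1]].
  have -> : E 0 = ht 2.
    (* The identity serves as the additive map, and the list is a single leaf. *)
    by rewrite -[LHS]/(idfun (E 0)) raddf_E /= big_seq1.
  by split=> //; rewrite /S_ linextU.
rewrite evcheb_err0S evcheb_err1S {}IH0 {}IH1.
rewrite !evcheb_shift // [evcheb x (E n.+1)]evchebE // evz_ES // evzV_ES.
rewrite [evcheb x (E n)]evchebE //; move: (evz x (E n)) (evz x^-1 (E n)) => p q.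
(* With [d = x - x^-1], [A = (x p - x^-1 q) / d] and [B = (p - q) / d], the identities rest on
   [A^2 - B^2 = (x p^2 - x^-1 q^2) / d] and [2 A - (x + x^-1) B = p + q]. *)
by split; field; rewrite x_neq0 sqr_sub1_neq0.
Qed.

End Invariant.

(** * Return to congruences modulo [KerL] *)

Lemma congr_KerL_err (F : fieldType) (f : {rmorphism {poly int} -> F}) n :
  injective f ->
  congr_KerL (err0 n) (E n) /\ congr_KerL (err1 n) (S_ (-1) (E n)).
Proof.
move=> f_inj.
have X_neq0 := rmorph_polyX_neq0 f_inj; have X_neqV := rmorph_polyX_neqV f_inj.
have ker y z : evcheb (f 'X) y = evcheb (f 'X) z -> congr_KerL y z.
  move=> yz; apply: (linext_cheb_eq0 f_inj).
  by rewrite -evcheb_L // raddfB /= yz subrr.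
by have [/ker e0 /ker e1] := evcheb_err X_neq0 X_neqV n.
Qed.

Theorem theorem5p2 (n : nat) :
  congr_KerL (err0 n) (E n) /\ congr_KerL (err1 n) (S_ (-1)%R (E n)).
Proof.
(* The transcendental point is the indeterminate in the fraction field of the integer
   polynomials. *)
apply: (@congr_KerL_err {fraction {poly int}} (@tofrac _)) => p q /eqP.
by rewrite tofrac_eq => /eqP.
Qed.
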